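(* Let $n>1$ be a fixed integer and define, for all sufficiently large real $x$ (say $x>en$), $$\mathcal{F}(x) := \left( \sum_{k=1}^{n} \frac{\pi(x/k)}{\log(x/k)} \right)^2 - \frac{ex}{\log x} \left( \sum_{k=1}^{n} \frac{\pi(x/(ek))}{\log(x/(ek))} \right).$$ Then, as $x\to\infty$, $$\mathcal{F}(x) = O\left(\frac{x^2}{(\log x)^3}\right),$$ and $\mathcal{F}(x)<0$ for all sufficiently large $x$.
   Context: For real $y>0$, $\pi(y)$ denotes the number of primes less than or equal to $y$; $\log$ is the natural logarithm and $e$ is its base. *)

(* Defs.v *)
From mathcomp Require Import all_boot all_order all_algebra finmap.
From mathcomp Require Import all_classical all_reals all_analysis.
Set Implicit Arguments.
Unset Strict Implicit.
Unset Printing Implicit Defensive.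
Import Order.TTheory GRing.Theory Num.Theory.
Import numFieldNormedType.Exports.
Local Open Scope classical_set_scope.
Local Open Scope ring_scope.

(* Lets the Landau notation =O_ +oo elaborate over a realType. *)
Canonical pinfty_filter_on (R : realType) :=
  @FilterType R (pinfty_nbhs R) _.

Definition prime_pi (R : realType) (y : R) : nat :=
  count prime (iota 0 (Num.truncn y).+1).

Lemma card_primes_le (R : realType) (y : R) :
  ([set p : nat | prime p /\ p%:R <= y] #= `I_(prime_pi y))%card.
Proof.
set s := [seq p <- iota 0 (Num.truncn y).+1 | prime p].
have -> : [set p : nat | prime p /\ p%:R <= y] = [set` [fset p in s]%fset].
  apply/seteqP; split => p /=; rewrite !inE mem_filter mem_iota add0n ltnS /=.
    case=> -> /= py; rewrite truncn_ge_nat //; exact: le_trans py.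
  move=> /andP[pp py]; split=> //.
  have t_gt0 : (0 < Num.truncn y)%N by rewrite (leq_trans _ py) ?prime_gt0.
  by rewrite -truncn_ge_nat // (le_trans ler01) // -truncn_gt0.
apply/card_eq_fsetP; rewrite card_fseq undup_id ?size_filter //.
by rewrite filter_uniq // iota_uniq.
Qed.

(* At arguments where some logarithm is ill-defined or zero this takes a default
   value; no such argument satisfies x > e * n. *)
Definition calF (R : realType) (n : nat) (x : R) : R :=
  (\sum_(1 <= k < n.+1) (prime_pi (x / k%:R))%:R / ln (x / k%:R)) ^+ 2
  - (expR 1 * x) / ln x *
    (\sum_(1 <= k < n.+1)
       (prime_pi (x / (expR 1 * k%:R)))%:R / ln (x / (expR 1 * k%:R))).

(* Main.v *)
Require Import Defs.
From mathcomp Require Import all_boot all_order all_algebra.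
From mathcomp Require Import all_classical all_reals all_analysis.
From mathcomp Require Import zify ring lra.
Set Implicit Arguments.
Unset Strict Implicit.
Unset Printing Implicit Defensive.
Import Order.TTheory GRing.Theory Num.Theory.
Import numFieldNormedType.Exports.

(** Only the order of magnitude of [pi] matters.  Write [L = ln x].  For fixed
[d] the logarithm of [x / d] is comparable to [L], so Chebyshev's theorem, that
[pi(y) ln y] lies between two positive multiples of [y], makes every quotient
[pi(x/d) / ln(x/d)] of exact order [x / L ^ 2].  Hence the squared sum in
[calF] is [O(x ^ 2 / L ^ 4)], while the subtracted product is squeezed between
two positive multiples of [x ^ 2 / L ^ 3] ([calF_estimates]).  The second term
therefore wins by a factor [L]: it gives the size of [calF] and its sign.

Chebyshev's bounds are proved from binomial coefficients.
- Upper bound ([chebyshev_upper]).  The primes in [m + 2 .. 2 m + 1] all divide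
  ['C(2 m + 1, m) <= 4 ^ m], so by induction the product of the primes up to
  [n] is at most [4 ^ n] ([primorial_le]).  All but at most [k] of these primes
  are at least [k], so [k ^ pi(n) <= k ^ k * 4 ^ n] ([expn_prime_count_le]); take [k] close
  to the square root of [n].
- Lower bound ([chebyshev_lower]).  By Legendre's formula every prime power in
  ['C(n, k)] is at most [n] ([expn_logn_bin_le]), so
  [2 ^ m <= 'C(2 m, m) <= (2 m) ^ pi(2 m)]. *)

(** * Counting and multiplying the primes up to n *)

(** The integer form of [prime_pi]: [prime_pi y] is convertible to
[prime_count (Num.truncn y)]. *)
Definition prime_count (n : nat) : nat := count prime (iota 0 n.+1).

Definition primorial (n : nat) : nat := \prod_(0 <= p < n.+1 | prime p) p.

Lemma prime_countS n : prime_count n.+1 = prime_count n + prime n.+1.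
Proof. by rewrite /prime_count -addn1 iotaD count_cat /= add0n addn0. Qed.

Lemma prime_count_le n : prime_count n <= n.
Proof. by elim: n => [|n IHn] //; rewrite prime_countS; case: (prime n.+1); lia. Qed.

Lemma leq_prime_count m n : m <= n -> prime_count m <= prime_count n.
Proof.
elim: n => [|n IHn]; first by case: m.
rewrite leq_eqVlt => /orP[/eqP -> //|]; rewrite ltnS prime_countS => /IHn; lia.
Qed.

Lemma primorialS n :
  primorial n.+1 = primorial n * (if prime n.+1 then n.+1 else 1).
Proof.
by rewrite /primorial big_mkcond big_nat_recr //= -big_mkcond.
Qed.

Lemma primorial_gt0 n : 0 < primorial n.
Proof. by apply: prodn_cond_gt0 => p; exact: prime_gt0. Qed.

Lemma prod_primes_dvdn s N : uniq s -> all prime s -> {in s, forall p, p %| N} ->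
  \prod_(p <- s) p %| N.
Proof.
elim: s => [|p s IHs] /=; first by rewrite big_nil dvd1n.
move=> /andP[ps us] /andP[pp sp] sN.
rewrite big_cons Gauss_dvd.
  rewrite sN ?mem_head //= IHs // => q qs.
  by rewrite sN // inE qs orbT.
rewrite big_seq; apply: (big_ind (fun q => coprime p q)).
- exact: coprimen1.
- by move=> a b; rewrite coprimeMr => -> ->.
move=> q qs; rewrite prime_coprime // dvdn_prime2 ?(allP sp q) //.
by apply: contraNneq ps => ->.
Qed.

Lemma prod_interval_primes_dvdn m n N :
  {in [pred p | m < p <= n], forall p, prime p -> p %| N} ->
  \prod_(m.+1 <= p < n.+1 | prime p) p %| N.
Proof.
move=> mnN; rewrite -big_filter; apply: prod_primes_dvdn.
- by rewrite filter_uniq // iota_uniq.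
- exact: filter_all.
move=> p; rewrite mem_filter mem_index_iota ltnS => /andP[pp mpn].
exact: mnN.
Qed.

Lemma dvdn_fact_prime p n : prime p -> (p %| n`!) = (p <= n).
Proof.
move=> pp; apply/idP/idP => [|pn]; last by rewrite dvdn_fact // prime_gt0.
elim: n => [|n IHn]; first by rewrite dvdn1 => /eqP p1; rewrite p1 in pp.
rewrite factS Euclid_dvdM // => /orP[/dvdn_leq -> //|/IHn]; exact: leqW.
Qed.

(** * The primorial is at most exponential *)

(** The two middle entries of row [2 m + 1] of Pascal's triangle are equal, and
the row sums to [2 * 4 ^ m]. *)
Lemma bin_odd_middle_le m : 'C(m.*2.+1, m) <= 4 ^ m.
Proof.
rewrite -(leq_pmul2l (isT : 0 < 2)).
have -> : 2 * 4 ^ m = 2 ^ m.*2.+1 by rewrite expnS -mul2n expnM.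
have sym : 'C(m.*2.+1, m.+1) = 'C(m.*2.+1, m).
  by rewrite -[RHS]bin_sub; [congr 'C(_, _); lia | lia].
have := @expnDn 1 1 m.*2.+1; rewrite addn1 => ->.
have Hm : m < m.*2.+2 by lia.
have HSm : m.+1 < m.*2.+2 by lia.
rewrite (bigD1 (Ordinal Hm)) // (bigD1 (Ordinal HSm)) /=; last first.
  by rewrite -val_eqE /= eqn_leq ltnn.
by rewrite !exp1n !muln1 sym addnA mul2n -addnn leq_addr.
Qed.

(** Erdos's induction.  An even [n > 2] is not prime, so nothing is gained in
passing from [n - 1] to [n]; for [n = 2 m + 1] the primes beyond [m + 1] divide
['C(n, m)], because they divide [n!] but neither [m!] nor [(m + 1)!]. *)
Lemma primorial_le n : primorial n <= 4 ^ n.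
Proof.
elim/ltn_ind: n => -[|[|[|n]]] IHn; try by rewrite /primorial unlock.
have [nodd|neven] := boolP (odd n); last first.
  have [m nm] : exists m, n.+3 = m.*2.+1 by exists n./2.+1; lia.
  have mlt : m.+1 < n.+3 by lia.
  rewrite {}nm in IHn mlt *.
  rewrite /primorial (@big_cat_nat _ _ _ m.+2) //=; last by lia.
  have -> : 4 ^ m.*2.+1 = 4 ^ m.+1 * 4 ^ m by rewrite -expnD; congr (_ ^ _); lia.
  apply: leq_mul; first exact: IHn.
  apply: leq_trans (bin_odd_middle_le m); apply: dvdn_leq; first by rewrite bin_gt0; lia.
  apply: prod_interval_primes_dvdn => p /andP[mp pm] pp.
  have := dvdn_fact_prime m.*2.+1 pp; rewrite pm -(@bin_fact _ m); last by lia.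
  rewrite !Euclid_dvdM // !dvdn_fact_prime //.
  by case/orP => // /orP[]; lia.
rewrite primorialS ifN ?muln1.
  by apply: leq_trans (IHn _ _) _ => //; rewrite leq_exp2l.
apply/negP => /even_prime[|]; lia.
Qed.

(** Among the primes up to [n], at most [k] are below [k], and each of the others
contributes a factor at least [k] to the primorial. *)
Lemma expn_prime_count_le k n : 0 < k -> k ^ prime_count n <= k ^ k * primorial n.
Proof.
move=> k0; elim: n => [|n IHn].
  by rewrite expn0 muln_gt0 primorial_gt0 expn_gt0 k0.
have [kn|nk] := leqP k n.+1; last first.
  rewrite (@leq_trans (k ^ k)) ?leq_pmulr ?primorial_gt0 //.
  by rewrite leq_pexp2l // (leq_trans (prime_count_le _)) // ltnW.
rewrite prime_countS primorialS expnD mulnA; apply: leq_mul => //.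
by case: ifP => _; rewrite ?expn1 ?expn0.
Qed.

(** * Central binomial coefficients are products of few prime powers *)

Lemma exp2_le_central_bin m : 2 ^ m <= 'C(m.*2, m).
Proof.
elim: m => [|m IHm] //.
(* Together: C(2m+2, m+1) (m+1) = 2 (2m+1) C(2m, m), at least 2 (m+1) C(2m, m). *)
have e1 := mul_bin_diag m.*2.+2 m.
have e2 := mul_bin_down m.*2.+1 m.
rewrite /= in e1 e2.
have e3 : (m.*2.+1 - m) = m.+1 by lia.
rewrite e3 in e2; rewrite doubleS expnS.
nia.
Qed.

(** In Legendre's formula the exponent of [p] in ['C(n, k)] is the sum over
[i >= 1] of [n %/ p ^ i - k %/ p ^ i - (n - k) %/ p ^ i].  Each summand is [0] or
[1], since adding [k] and [n - k] modulo [p ^ i] produces at most one carry, and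
it vanishes once [p ^ i > n].  So the exponent is at most the integer part of
the base-[p] logarithm of [n]. *)
Lemma expn_logn_bin_le p n k : prime p -> 0 < n -> k <= n -> p ^ logn p 'C(n, k) <= n.
Proof.
move=> pp n0 kn.
have p1 := prime_gt1 pp.
have lognE : logn p 'C(n, k) <= \sum_(1 <= i < n.+1) (i <= trunc_log p n).
  have := congr1 (logn p) (bin_fact kn).
  rewrite !lognM ?muln_gt0 ?fact_gt0 ?bin_gt0 // !logn_fact //.
  (* Summing all three Legendre formulas over the same range only adds zeros. *)
  have widen j : j <= n ->
      \sum_(1 <= i < j.+1) j %/ p ^ i = \sum_(1 <= i < n.+1) j %/ p ^ i.
    move=> jn; rewrite [RHS](@big_cat_nat _ _ _ j.+1) //= [X in _ = _ + X]big_nat_cond.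
    rewrite [X in _ = _ + X]big1 ?addn0 // => i /andP[/andP[ji _] _].
    by rewrite divn_small // (leq_trans ji) // ltnW // ltn_expl.
  rewrite (widen k) // (widen (n - k)) ?leq_subr //.
  move=> e; rewrite -(leq_add2r (\sum_(1 <= i < n.+1) k %/ p ^ i
    + \sum_(1 <= i < n.+1) (n - k) %/ p ^ i)) e.
  rewrite -!big_split /= !big_nat; apply: leq_sum => i _.
  have pi0 : 0 < p ^ i by rewrite expn_gt0 prime_gt0.
  have [it|ti] := leqP i (trunc_log p n).
    rewrite -{1}(subnK kn) [n - k + k]addnC divnD // addnC leq_add2r.
    by rewrite leq_b1.
  rewrite divn_small //.
  by rewrite (leq_trans (trunc_log_ltn n p1)) // leq_pexp2l // ltnW.
apply: leq_trans (trunc_logP p1 n0).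
rewrite leq_pexp2l ?(ltnW p1) // (leq_trans lognE) //.
move: (trunc_log p n) => t; clear.
suff: \sum_(1 <= i < n.+1) (i <= t) <= minn n t by lia.
elim: n => [|n IHn]; first by rewrite big_geq.
by rewrite big_nat_recr //=; lia.
Qed.

(** The prime factorization of ['C(n, k)] has at most [prime_count n] prime
powers, all of them at most [n]. *)
Lemma bin_le_expn_prime_count n k : k <= n -> 'C(n, k) <= n ^ prime_count n.
Proof.
move=> kn; have [n0|n0] := posnP n.
  by move: kn; rewrite n0 leqn0 => /eqP ->.
rewrite [leqLHS]prod_prime_decomp ?bin_gt0 // prime_decompE big_map /=.
apply: (@leq_trans (\prod_(p <- primes 'C(n, k)) n)).
  rewrite !big_seq; apply: leq_prod => p; rewrite mem_primes => /andP[pp _].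
  exact: expn_logn_bin_le.
rewrite big_const_seq count_predT iter_muln_1 leq_pexp2l //.
rewrite /prime_count -size_filter; apply: uniq_leq_size; first exact: primes_uniq.
move=> p; rewrite mem_primes mem_filter mem_iota => /and3P[pp C0 pC]; rewrite pp /=.
rewrite ltnS -(dvdn_fact_prime n pp) -(bin_fact kn); exact: dvdn_mulr.
Qed.

Lemma exp2_le_expn_prime_count m : 2 ^ m <= m.*2 ^ prime_count m.*2.
Proof.
apply: leq_trans (exp2_le_central_bin m) _.
apply: bin_le_expn_prime_count; rewrite -addnn; exact: leq_addr.
Qed.

Local Open Scope classical_set_scope.
Local Open Scope ring_scope.

Lemma ln2_ge (R : realType) : 1 / 2 <= ln (2 : R).
Proof.
have := @le_ln1Dx R (- (1 / 2)) ltac:(lra).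
have -> : 1 + - (1 / 2) = 2^-1 :> R by lra.
by rewrite lnV ?posrE //; lra.
Qed.

Lemma ln4_le (R : realType) : ln (4 : R) <= 3.
Proof.
have := @le_ln1Dx R 3 ltac:(lra).
by have -> : 1 + 3 = 4 :> R by lra.
Qed.

(** From [exp (- 1 / 2) >= 1 / 2], squared and inverted. *)
Lemma expR1_le4 (R : realType) : expR 1 <= 4 :> R.
Proof.
have h := @expR_ge1Dx R (- (1 / 2)).
have e : expR 1 * (expR (- (1 / 2)) * expR (- (1 / 2))) = 1 :> R.
  by rewrite -!expRD -[RHS]expR0; congr expR; lra.
set h' := expR (- _) in h e; have h4 : 1 / 4 <= h' * h' by nra.
have := expR_ge0 (1 : R); nra.
Qed.

(** * Chebyshev's bounds *)

(** With [k] just above the square root of [x] we have [ln x <= 2 ln k], whereas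
[k ln k <= k ^ 2 <= 4 x]; the inequality [k ^ pi(x) <= k ^ k * 4 ^ x] then gives
[pi(x) ln k <= 4 x + 3 x]. *)
Lemma chebyshev_upper (R : realType) (x : R) : 1 <= x ->
  (prime_pi x)%:R * ln x <= 14 * x.
Proof.
move=> x1; have x0 : 0 <= x by lra.
have [sx0 sx1 sxx] : [/\ 0 <= Num.sqrt x, 1 <= Num.sqrt x
    & Num.sqrt x * Num.sqrt x = x].
  split; [exact: sqrtr_ge0| |by rewrite -expr2 sqr_sqrtr].
  by rewrite -[leLHS]sqrtr1 ler_wsqrtr.
set k := (Num.truncn (Num.sqrt x)).+1.
have /andP[kl kg] : k%:R - 1 <= Num.sqrt x < k%:R.
  have := truncn_itv sx0; rewrite /k -natr1 => /andP[h1 h2].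
  by rewrite h2 andbT; lra.
have k0 : 0 < k%:R :> R by rewrite ltr0n.
have lnx : ln x <= 2 * ln (k%:R : R).
  have -> : 2 * ln (k%:R : R) = ln (k%:R * k%:R) by rewrite lnM ?posrE //; lra.
  rewrite ler_ln ?posrE; [|lra|by rewrite mulr_gt0]; nra.
have H := leq_trans (expn_prime_count_le (Num.truncn x) (ltn0Sn _ : 0 < k)%N)
  (leq_mul (leqnn _) (primorial_le (Num.truncn x))).
have {H} : (prime_pi x)%:R * ln (k%:R : R)
    <= k%:R * ln k%:R + (Num.truncn x)%:R * ln 4.
  rewrite ![_%:R * ln _]mulr_natl -!lnXn // -lnM ?posrE ?exprn_gt0 //.
  rewrite ler_ln ?posrE ?mulr_gt0 ?exprn_gt0 //.
  by rewrite -!natrX -natrM ler_nat.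
have lnk : ln (k%:R : R) < k%:R by exact: ln_sublinear.
have tx : (Num.truncn x)%:R <= x by rewrite truncn_le.
have := ln4_le R; have t0 : 0 <= (Num.truncn x)%:R :> R by exact: ler0n.
have p0 : 0 <= (prime_pi x)%:R :> R by exact: ler0n.
move=> l4 H.
have : (prime_pi x)%:R * ln x <= (prime_pi x)%:R * (2 * ln (k%:R : R)).
  exact: ler_wpM2l.
have : k%:R * ln k%:R <= (2 * Num.sqrt x) * (2 * Num.sqrt x).
  by apply: ler_pM => //; [apply: ln_ge0; rewrite ler1n|lra|lra].
have : (Num.truncn x)%:R * ln 4 <= x * 3 :> R.
  by apply: ler_pM => //; apply: ln_ge0; lra.
nra.
Qed.

(** Taking logarithms in [2 ^ m <= (2 m) ^ pi(2 m)] with [m] the integer part of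
[x / 2], which is at least [x / 4]. *)
Lemma chebyshev_lower (R : realType) (x : R) : 4 <= x ->
  x / 8 <= (prime_pi x)%:R * ln x.
Proof.
move=> x4; have x0 : 0 <= x by lra.
set m := Num.truncn (x / 2).
have /andP[ml mg] : m%:R <= x / 2 < m%:R + 1.
  by rewrite natr1; apply: truncn_itv; lra.
have m0 : (0 < m)%N by rewrite truncn_gt0; lra.
have mx : m.*2%:R <= x by rewrite -muln2 natrM; lra.
have mt : (m.*2 <= Num.truncn x)%N by rewrite truncn_ge_nat.
have H : m%:R * ln 2 <= (prime_count m.*2)%:R * ln (m.*2%:R : R).
  have p2 : 0 < m.*2%:R :> R by rewrite ltr0n double_gt0.
  rewrite ![_%:R * ln _]mulr_natl -!lnXn //.
  rewrite ler_ln ?posrE ?exprn_gt0 //.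
  rewrite -!natrX ler_nat; exact: exp2_le_expn_prime_count.
have : (prime_count m.*2)%:R * ln (m.*2%:R : R) <= (prime_pi x)%:R * ln x.
  apply: ler_pM => //; first by apply: ln_ge0; rewrite ler1n double_gt0.
    by rewrite ler_nat; exact: leq_prime_count.
  by rewrite ler_ln ?posrE ?ltr0n ?double_gt0 //; lra.
have : m%:R * (1 / 2) <= m%:R * ln (2 : R) by apply: ler_wpM2l => //; exact: ln2_ge.
lra.
Qed.

(** * Size of the summands and of calF *)

Lemma half_ln_le (R : realType) (x d : R) : 0 < d -> d ^+ 2 <= x ->
  ln x / 2 <= ln (x / d).
Proof.
move=> d0 dx; have x0 : 0 < x by apply: lt_le_trans dx; exact: exprn_gt0.
have : ln (d ^+ 2) <= ln x by rewrite ler_ln ?posrE ?exprn_gt0.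
rewrite lnXn // ln_div ?posrE //; lra.
Qed.

(** Chebyshev's upper bound at [x / d] gives [14 x / ln (x / d) ^ 2], and
[ln (x / d) >= ln x / 2] turns [14] into [56 = 4 * 14]. *)
Lemma pi_over_ln_upper (R : realType) (x d : R) : 1 <= d -> d ^+ 2 <= x -> 1 < x ->
  (prime_pi (x / d))%:R / ln (x / d) <= 56 * (x / ln x ^+ 2).
Proof.
move=> d1 dx x1; have d0 : 0 < d by lra.
have L0 := ln_gt0 x1.
have l := half_ln_le d0 dx.
have xd : x / d <= x by rewrite ler_pdivrMr //; nra.
have xd1 : 1 <= x / d by rewrite ler_pdivlMr //; nra.
have cu := chebyshev_upper xd1.
have l0 : 0 < ln (x / d) by lra.
rewrite mulrA ler_pdivrMr // mulrAC ler_pdivlMr ?exprn_gt0 //.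
have p0 : 0 <= (prime_pi (x / d))%:R :> R by exact: ler0n.
set p := (prime_pi _)%:R in cu p0 *; set l' := ln (x / d) in l cu l0 *.
have : p * ln x ^+ 2 <= p * (4 * l' ^+ 2) by apply: ler_wpM2l => //; nra.
have : p * l' * l' <= 14 * x * l' by apply: ler_wpM2r; lra.
nra.
Qed.

Lemma pi_over_ln_lower (R : realType) (x d : R) : 1 <= d -> d ^+ 2 <= x -> 16 <= x ->
  x / d / 8 / ln x ^+ 2 <= (prime_pi (x / d))%:R / ln (x / d).
Proof.
move=> d1 dx x16; have d0 : 0 < d by lra.
have L0 : 0 < ln x by apply: ln_gt0; lra.
have l := half_ln_le d0 dx.
have xd : x / d <= x by rewrite ler_pdivrMr //; nra.
have xd4 : 4 <= x / d.
  rewrite ler_pdivlMr //; nra.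
have cl := chebyshev_lower xd4.
have l0 : 0 < ln (x / d) by lra.
have ll : ln (x / d) <= ln x by rewrite ler_ln ?posrE //; lra.
have p0 : 0 <= (prime_pi (x / d))%:R :> R by exact: ler0n.
rewrite ler_pdivrMr ?exprn_gt0 // [leRHS]mulrAC ler_pdivlMr //.
set p := (prime_pi _)%:R in cl p0 *; set l' := ln (x / d) in l cl l0 ll *.
have : x / d / 8 * l' <= p * l' * l' by apply: ler_wpM2r; lra.
have : p * (l' ^+ 2) <= p * (ln x ^+ 2) by apply: ler_wpM2l => //; nra.
nra.
Qed.

(** The sums involve [x / d] for [d = c k], with [c = 1] or [c = e] and
[k <= n]; since [d <= 4 n], the condition [16 n ^ 2 <= x] makes the bounds on
[pi(x/d) / ln(x/d)] apply to all of them.  The lower bound on [B] keeps only the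
term [k = 1] of its sum, all terms being nonnegative. *)
Lemma calF_estimates (R : realType) (n : nat) (x : R) :
  (0 < n)%N -> 16 * n%:R ^+ 2 <= x ->
  exists A B : R,
  [/\ calF n x = A - B, 0 <= A <= (56 * n%:R) ^+ 2 * (x ^+ 2 / ln x ^+ 4)
    & x ^+ 2 / ln x ^+ 3 / 8 <= B <= 224 * n%:R * (x ^+ 2 / ln x ^+ 3)].
Proof.
move=> n0 nx; have n1 : 1 <= n%:R :> R by rewrite ler1n.
have x16 : 16 <= x by nra.
have L0 : 0 < ln x by apply: ln_gt0; lra.
have e1 : 1 <= expR 1 :> R by rewrite ltW // expR_gt1.
have e4 := expR1_le4 R.
have dom (c : R) k : 1 <= c <= 4 -> (1 <= k < n.+1)%N ->
    1 <= c * k%:R /\ (c * k%:R) ^+ 2 <= x.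
  move=> c14 /andP[k1 kn]; have : 1 <= k%:R :> R by rewrite ler1n.
  have : k%:R <= n%:R :> R by rewrite ler_nat.
  move=> k1' kn'; split; first by nra.
  have : c * k%:R <= 4 * n%:R by apply: ler_pM; lra.
  have : 0 <= c * k%:R by apply: mulr_ge0; lra.
  nra.
have cx (c : R) k : 1 <= c <= 4 -> (1 <= k < n.+1)%N ->
    0 <= (prime_pi (x / (c * k%:R)))%:R / ln (x / (c * k%:R))
      <= 56 * (x / ln x ^+ 2).
  move=> c14 kn; have [d1 dx] := dom c k c14 kn.
  rewrite pi_over_ln_upper ?andbT //; last by lra.
  apply: le_trans (pi_over_ln_lower d1 dx x16).
  by rewrite !divr_ge0 ?sqr_ge0 //; lra.
have sum_bounds (c : R) : 1 <= c <= 4 ->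
    0 <= \sum_(1 <= k < n.+1)
      (prime_pi (x / (c * k%:R)))%:R / ln (x / (c * k%:R))
    <= n%:R * (56 * (x / ln x ^+ 2)).
  move=> c14; apply/andP; split.
    by rewrite big_nat; apply: sumr_ge0 => k /(cx c k c14)/andP[].
  apply: (@le_trans _ _ (\sum_(1 <= k < n.+1) 56 * (x / ln x ^+ 2))).
    by rewrite !big_nat; apply: ler_sum => k /(cx c k c14)/andP[].
  by rewrite sumr_const_nat subSS subn0 [leRHS]mulr_natl.
rewrite /calF; set S1 := \sum_(1 <= k < _) _; set S2 := \sum_(1 <= k < _) _.
have /andP[S1_ge0 S1_le] : 0 <= S1 <= n%:R * (56 * (x / ln x ^+ 2)).
  have := sum_bounds 1; under eq_bigr do rewrite mul1r; apply; lra.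
have /andP[S2_ge0 S2_le] : 0 <= S2 <= n%:R * (56 * (x / ln x ^+ 2)).
  by apply: sum_bounds; lra.
have S2_ge : x / (expR 1 * 1%:R) / 8 / ln x ^+ 2 <= S2.
  have c14 : 1 <= (expR 1 : R) <= 4 by lra.
  have [d1 dx] := dom _ 1%N c14 n0.
  apply: le_trans (pi_over_ln_lower d1 dx x16) _.
  rewrite /S2 big_ltn // lerDl big_nat; apply: sumr_ge0 => k /andP[k1 kn].
  by have /andP[] := cx (expR 1) k c14 ltac:(lia).
have xL0 : 0 <= x / ln x by rewrite divr_ge0 //; lra.
exists (S1 ^+ 2), (expR 1 * x / ln x * S2); split=> //.
  rewrite sqr_ge0 /=.
  have -> : (56 * n%:R) ^+ 2 * (x ^+ 2 / ln x ^+ 4)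
      = (n%:R * (56 * (x / ln x ^+ 2))) ^+ 2.
    by field; exact: lt0r_neq0.
  by rewrite lerXn2r ?nnegrE //; apply: le_trans S1_le.
apply/andP; split.
  have -> : x ^+ 2 / ln x ^+ 3 / 8
      = expR 1 * x / ln x * (x / (expR 1 * 1%:R) / 8 / ln x ^+ 2).
    by field; rewrite !lt0r_neq0 //; lra.
  by apply: ler_wpM2l => //; rewrite -mulrA mulr_ge0 //; lra.
have -> : 224 * n%:R * (x ^+ 2 / ln x ^+ 3)
    = 4 * x / ln x * (n%:R * (56 * (x / ln x ^+ 2))).
  by field; exact: lt0r_neq0.
rewrite -![_ * x / _]mulrA; apply: ler_pM => //.
  by rewrite mulr_ge0 //; lra.
exact: ler_wpM2r.
Qed.

Theorem theorem4p3 (R : realType) (n : nat) (hn : (1 < n)%N) :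
  (calF n : R -> R) =O_ +oo (fun x : R => x ^+ 2 / ln x ^+ 3) /\
  (\forall x \near +oo, calF n (x : R) < 0).
Proof.
have n0 : (0 < n)%N by exact: ltnW.
set C : R := (56 * n%:R) ^+ 2.
have C0 : 0 <= C by exact: sqr_ge0.
(* Beyond this point ln x > 8 C, so the bound C x^2 / (ln x)^4 on the squared sum
   drops below the lower bound x^2 / (8 (ln x)^3) on the subtracted term. *)
pose x0 : R := Num.max (16 * n%:R ^+ 2) (expR (8 * C + 1)).
have large (x : R) : x0 < x -> [/\ 16 * n%:R ^+ 2 <= x, 0 < x & 8 * C + 1 < ln x].
  rewrite gt_max => /andP[nx ex]; have x_gt0 := lt_trans (expR_gt0 _) ex.
  by split=> //; [exact: ltW | rewrite -ltr_expR lnK].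
have A_le (x : R) : x0 < x -> C * (x ^+ 2 / ln x ^+ 4) < x ^+ 2 / ln x ^+ 3 / 8.
  move=> /large[_ x_gt0 Lx]; have L0 : 0 < ln x by lra.
  have -> : C * (x ^+ 2 / ln x ^+ 4) = x ^+ 2 / ln x ^+ 3 * (C / ln x).
    by field; exact: lt0r_neq0.
  rewrite ltr_pM2l ?divr_gt0 ?exprn_gt0 // ltr_pdivrMr //; lra.
split.
  apply/eqO_exP; exists (1 + 224 * n%:R); first by rewrite ltr_wpDr.
  near=> x.
  have xx0 : x0 < x by near: x; apply: nbhs_pinfty_gt; exact: num_real.
  have [nx x_gt0 Lx] := large x xx0.
  have [A [B [-> /andP[A0 AC] /andP[B0 BC]]]] := calF_estimates n0 nx.
  have A_lt := le_lt_trans AC (A_le x xx0).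
  have D0 : 0 <= x ^+ 2 / ln x ^+ 3 by rewrite ltW // divr_gt0 ?exprn_gt0 //; lra.
  rewrite [X in _ <= _ * X]ger0_norm // ler_norml mulrDl mul1r; lra.
near=> x.
have xx0 : x0 < x by near: x; apply: nbhs_pinfty_gt; exact: num_real.
have [nx x_gt0 Lx] := large x xx0.
have [A [B [-> /andP[A0 AC] /andP[B0 BC]]]] := calF_estimates n0 nx.
have := le_lt_trans AC (A_le x xx0); lra.
Unshelve. all: by end_near.
Qed.
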